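(* Let $X=(X(t))_{t\in[0,1]}$ be a real-valued stochastic process with càdlàg trajectories and let $0<q<1$, $p>0$. Suppose that $p\le 1$ and that for all $k\ge1$ and all $s,t\in[0,1]$ $$\|X(t)-X(s)\|_k\le C_1k^p|s-t|^q .$$ Then $$\mathbf{P}\big(TV^c(X)\ge D\,u\,c^{1-\frac1q}\big)\le \exp\big(-u^{\frac qp}\big)\quad\text{for } u\ge1,$$ where $D$ is a universal constant.
   Context: $C_1$ is a positive constant (not depending on $k,s,t$), and $c>0$ is given. $\|Y\|_k=(\mathbf{E}|Y|^k)^{1/k}$ for a random variable $Y$. The truncated variation of $X$ on $[0,1]$ is $$TV^{c}(X)=\sup_{n}\ \sup_{0=t_0<t_1<\dots<t_n=1}\ \sum_{i=1}^{n}\max\{|X(t_i)-X(t_{i-1})|-c,\,0\}.$$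
   Formalization: The ''universal constant'' D is allowed to depend on C_1 and q (only), not on p, X, c or u; a D independent of C_1 or q is impossible, e.g. X(t)=4t, C_1=4, c=2, u=1 forces D > 2^{1/q}. *)

(* Defs.v *)
From HB Require Import structures.
From mathcomp Require Import all_boot all_order all_algebra.
From mathcomp Require Import all_classical all_reals all_analysis.

Set Implicit Arguments.
Unset Strict Implicit.
Unset Printing Implicit Defensive.

Import Order.TTheory GRing.Theory Num.Theory.
Import numFieldNormedType.Exports.

Local Open Scope classical_set_scope.
Local Open Scope ring_scope.

(* Only the values of f on [a, b] matter: the limits are one-sided, taken from
   inside [a, b]. *)
Definition cadlag (R : realType) (a b : R) (f : R -> R) : Prop :=
  (forall t, a <= t < b -> f x @[x --> t^'+] --> f t) /\
  (forall t, a < t <= b -> exists l : R, f x @[x --> t^'-] --> l).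

(* The subdivision is a :: s, as in the library's [variation]. *)
Definition truncated_variation_on (R : realType) (c a b : R) (f : R -> R)
    (s : seq R) : R :=
  let F := f \o nth b (a :: s) in
  \sum_(0 <= i < size s) Num.max (`|F i.+1 - F i| - c) 0.

Definition truncated_variation (R : realType) (c a b : R) (f : R -> R)
    : \bar R :=
  ereal_sup [set (truncated_variation_on c a b f s)%:E
            | s in itv_partition a b].

(* Main.v *)
(** Chaining. An increment over dyadic points telescopes into increments over
    dyadic intervals, at most two per level, so if the thresholds [w n] satisfy
    [2 * \sum_n w n <= c] then each term [max (|X t - X s| - c) 0] is at most
    the sum of the [max (|Delta_I X| - w n) 0] over the dyadic intervals [I] of
    level [n] used for [[s, t]]. Distinct steps of a subdivision use distinct
    [I], hence TV^c is bounded by the sum over all dyadic intervals; right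
    continuity reduces arbitrary subdivisions to dyadic ones and makes TV^c
    measurable. The terms have k-th moments at most [b n ^ k] with
    [\sum_n 2^n b n] of order [k^(p/q) c^(1-1/q)], and Markov's inequality for
    the k-th power with [k] close to [u^(q/p)] gives the tail. *)
Require Import Defs.
From HB Require Import structures.
From mathcomp Require Import all_boot all_order all_algebra.
From mathcomp Require Import all_classical all_reals all_analysis.
From mathcomp Require Import measurable_realfun zify lra ring.

Set Implicit Arguments.
Unset Strict Implicit.
Unset Printing Implicit Defensive.

Import Order.TTheory GRing.Theory Num.Theory.
Import numFieldNormedType.Exports.

Local Open Scope classical_set_scope.
Local Open Scope ring_scope.

(** * Excesses over a threshold and dyadic chaining for a fixed path *)

Definition excess (R : realType) (c x : R) : R := Num.max (x - c) 0.

Lemma excess_ge0 (R : realType) (c x : R) : 0 <= excess c x.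
Proof. by rewrite /excess le_max lexx orbT. Qed.

Lemma le_excess (R : realType) (c x : R) : x <= c + excess c x.
Proof. by rewrite -lerBlDl /excess le_max lexx. Qed.

(** The index type is arbitrary because the same sum is taken over real subdivisions and over
    integer indices of dyadic points. *)
Fixpoint tv_sum (R : realType) (T : Type) (c : R) (h : T -> R) (a : T)
    (s : seq T) : R :=
  if s is b :: s' then excess c `|h b - h a| + tv_sum c h b s' else 0.

(* The excesses over the dyadic intervals [i 2^m, (i+1) 2^m] contained in
   [a, b]; level [m = 0] is the finest one. *)
Definition dyadic_excess (R : realType) (cw : nat -> R) (h : nat -> R)
    (M a b : nat) : R :=
  \sum_(m < M.+1) \sum_(i < 2 ^ (M - m) | ((a <= i * 2 ^ m) && (i.+1 * 2 ^ m <= b))%N)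
    excess (cw m) `|h (i.+1 * 2 ^ m)%N - h (i * 2 ^ m)%N|.

Lemma dyadic_excess_ge0 (R : realType) (cw : nat -> R) (h : nat -> R)
    (M a b : nat) : 0 <= dyadic_excess cw h M a b.
Proof.
by apply: sumr_ge0 => m _; apply: sumr_ge0 => i _; exact: excess_ge0.
Qed.

(** Dyadic intervals have positive length, so none lies both in [[a, b]] and in [[b, e]]: nothing is
    counted twice when the steps of a subdivision are added up. *)
Lemma dyadic_excess_superadditive (R : realType) (cw : nat -> R) (h : nat -> R)
    (M a b e : nat) : (a <= b)%N -> (b <= e)%N ->
  dyadic_excess cw h M a b + dyadic_excess cw h M b e
    <= dyadic_excess cw h M a e.
Proof.
move=> ab be; rewrite -big_split/=; apply: ler_sum => m _.
rewrite !(big_mkcond (fun i : 'I__ => _ && _))/= -big_split/=.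
apply: ler_sum => i _.
have : (0 < 2 ^ m)%N by rewrite expn_gt0.
set z := excess _ _; have : 0 <= z by exact: excess_ge0.
set l := (i * 2 ^ m)%N; rewrite mulSn -/l => z0 m0.
have [] := boolP ((a <= l) && (2 ^ m + l <= b))%N;
  have [] := boolP ((b <= l) && (2 ^ m + l <= e))%N;
  have [] := boolP ((a <= l) && (2 ^ m + l <= e))%N; rewrite ?addr0 ?add0r//; lia.
Qed.

Lemma ler_sum_single (R : realType) (n : nat) (P : pred nat) (f : nat -> R)
    (i : nat) : (forall j, 0 <= f j) -> (i < n)%N -> P i ->
  f i <= \sum_(j < n | P j) f j.
Proof.
move=> f0 lt_in Pi; rewrite (bigD1 (Ordinal lt_in))//= lerDl.
by apply: sumr_ge0 => j _.
Qed.

Lemma ler_sum_pair (R : realType) (n : nat) (P : pred nat) (f : nat -> R)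
    (i k : nat) : (forall j, 0 <= f j) -> (i < n)%N -> (k < n)%N -> P i -> P k ->
  k != i -> f i + f k <= \sum_(j < n | P j) f j.
Proof.
move=> f0 lt_in lt_kn Pi Pk ki; rewrite (bigD1 (Ordinal lt_in))//= lerD2l.
rewrite (bigD1 (Ordinal lt_kn))/= ?Pk//= lerDl.
by apply: sumr_ge0 => j _.
Qed.

(** Induction on [M]. Moving [a] up and [b] down to even indices uses at most one finest interval at
    each end, each costing [cw 0] plus its excess. Halving the even indices leaves the same problem
    for [h \o double] with thresholds [cw \o S]. *)
Lemma dyadic_chaining (R : realType) (M : nat) (cw : nat -> R) (h : nat -> R)
    (a b : nat) : (forall m, 0 <= cw m) -> (a <= b <= 2 ^ M)%N ->
  `|h b - h a| <= 2 * (\sum_(m < M.+1) cw m) + dyadic_excess cw h M a b.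
Proof.
elim: M cw h a b => [|M IH] cw h a b cw0 /andP[ab bM].
  have S0 : 0 <= \sum_(m < 1) cw m by apply: sumr_ge0.
  have [->|ab'] := eqVneq a b.
    by rewrite subrr normr0 addr_ge0 ?dyadic_excess_ge0 ?mulr_ge0.
  have [-> ->] : a = 0%N /\ b = 1%N by move: bM; rewrite expn0; lia.
  rewrite /dyadic_excess !big_ord1 subnn expn0 big_mkcond big_ord1/=.
  rewrite mul0n mul1n.
  have := le_excess (cw 0) `|h 1 - h 0|; have := cw0 0; lra.
have S0 : 0 <= \sum_(m < M.+2) cw m by apply: sumr_ge0.
have [->|ab'] := eqVneq a b.
  by rewrite subrr normr0 addr_ge0 ?dyadic_excess_ge0 ?mulr_ge0.
have {ab ab'}ab : (a < b)%N by rewrite ltn_neqAle ab' ab.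
(* Rounding inward keeps the endpoints in order only when [a < b], hence the separate case
   [a = b]. *)
have ab2 : (uphalf a <= b./2 <= 2 ^ M)%N by move: bM; rewrite expnS; lia.
have := IH (cw \o S) (h \o double) (uphalf a) (b./2) (fun m => cw0 m.+1) ab2.
rewrite /= => {}IH.
have tri : `|h b - h a| <= `|h b - h b./2.*2| +
    `|h b./2.*2 - h (uphalf a).*2| + `|h (uphalf a).*2 - h a|.
  rewrite (_ : h b - h a = (h b - h b./2.*2) + (h b./2.*2 - h (uphalf a).*2)
    + (h (uphalf a).*2 - h a)); last by ring.
  by rewrite (le_trans (ler_normD _ _))// lerD2r ler_normD.
pose f i := excess (cw 0) `|h i.+1 - h i|.
have f0 i : 0 <= f i by exact: excess_ge0.
set fine := \sum_(i < 2 ^ M.+1 | ((a <= i) && (i.+1 <= b))%N) f i.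
(* The rescaled intervals are those of level at least 1 in the original grid; [fine] is level 0. *)
have coarse : fine + dyadic_excess (cw \o S) (h \o double) M (uphalf a) b./2
    <= dyadic_excess cw h M.+1 a b.
  rewrite {2}/dyadic_excess big_ord_recl; apply: lerD.
    rewrite le_eqVlt; apply/orP; left; apply/eqP.
    by rewrite /fine subn0; apply: eq_big => i; rewrite ?expn0 ?muln1.
  apply: ler_sum => m _; rewrite lift0 subSS/=.
  rewrite big_mkcond [leRHS]big_mkcond/=; apply: ler_sum => i _.
  rewrite -!mul2n !(mulnCA 2%N) -!expnS.
  case: ifPn => [H|_]; last by case: ifP => // _; exact: excess_ge0.
  rewrite ifT//; move: H; rewrite expnS (mulnCA i) (mulnCA i.+1); lia.
have finish : `|h b - h b./2.*2| + `|h (uphalf a).*2 - h a| <= 2 * cw 0 + fine.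
  have pr i k : (i < 2 ^ M.+1)%N -> (k < 2 ^ M.+1)%N -> ((a <= i) && (i.+1 <= b))%N ->
      ((a <= k) && (k.+1 <= b))%N -> k != i -> f i + f k <= fine.
    exact: (@ler_sum_pair R _ (fun i => (a <= i) && (i.+1 <= b))%N).
  have sg i : (i < 2 ^ M.+1)%N -> ((a <= i) && (i.+1 <= b))%N -> f i <= fine.
    exact: (@ler_sum_single R _ (fun i => (a <= i) && (i.+1 <= b))%N).
  have oddb : odd b -> `|h b - h b./2.*2| <= cw 0 + f b.-1.
    move=> ob; rewrite /f.
    have -> : b./2.*2 = b.-1 by clear -ob ab; lia.
    by rewrite prednK; [exact: le_excess|clear -ab; lia].
  have oa' : odd a -> `|h (uphalf a).*2 - h a| <= cw 0 + f a.
    move=> oa; rewrite /f.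
    have -> : (uphalf a).*2 = a.+1 by clear -oa; lia.
    exact: le_excess.
  have evb : ~~ odd b -> `|h b - h b./2.*2| = 0.
    move=> ob; rewrite (_ : b./2.*2 = b) ?subrr ?normr0//; clear -ob; lia.
  have eva : ~~ odd a -> `|h (uphalf a).*2 - h a| = 0.
    move=> oa; rewrite (_ : (uphalf a).*2 = a) ?subrr ?normr0//; clear -oa; lia.
  have c0 := cw0 0.
  have sum0 : 0 <= fine by apply: sumr_ge0.
  have aM : (a < 2 ^ M.+1)%N := leq_trans ab bM.
  have bM' : (b.-1 < 2 ^ M.+1)%N by rewrite prednK// (leq_ltn_trans _ ab).
  have Pa : ((a <= a) && (a.+1 <= b))%N by rewrite leqnn.
  have Pb : ((a <= b.-1) && (b.-1.+1 <= b))%N by clear -ab; lia.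
  have [ob|ob] := boolP (odd b); have [oa|oa] := boolP (odd a).
  (* Here [b.-1] is even and [a] is odd, so the two end intervals differ and [fine] contains both
     excesses. *)
  - have := pr b.-1 a bM' aM Pb Pa ltac:(clear -ob oa ab; lia).
    have := oddb ob; have := oa' oa; lra.
  - have := sg b.-1 bM' Pb.
    rewrite eva//; have := oddb ob; lra.
  - have := sg a aM Pa.
    rewrite evb//; have := oa' oa; lra.
  - rewrite evb// eva//; lra.
rewrite big_ord_recl; under eq_bigr do rewrite lift0; move: tri IH coarse finish; lra.
Qed.

Lemma tv_sum_dyadic (R : realType) (M : nat) (c : R) (cw : nat -> R)
    (h : nat -> R) (a : nat) (s : seq nat) : (forall m, 0 <= cw m) ->
  2 * (\sum_(m < M.+1) cw m) <= c ->
  path leq a s -> (last a s <= 2 ^ M)%N ->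
  tv_sum c h a s <= dyadic_excess cw h M a (last a s).
Proof.
move=> cw0 cwc; elim: s a => [|b s IH] a /=; first by rewrite dyadic_excess_ge0.
move=> /andP[ab pth] lM.
have bl : (b <= last b s)%N.
  have /allP ball := order_path_min leq_trans pth.
  by have /predU1P[->//|/ball] := mem_last b s.
apply: le_trans (dyadic_excess_superadditive _ _ _ ab bl).
apply: lerD; last exact: IH.
rewrite /excess ge_max dyadic_excess_ge0 andbT lerBlDl.
apply: le_trans (@dyadic_chaining R M cw h a b cw0 _) _; first by lia.
by rewrite lerD2r.
Qed.

(** * Tail of a sum from moments, and moments of excesses *)

(** Convexity of the power on the nonnegative reals; the slack in the induction step is
    [n * p * (z - t) ^+ 2]. *)
Lemma ler_tangent_exprn (R : realType) (k : nat) (t z : R) : 0 <= t -> 0 <= z ->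
  t ^+ k.+1 + k.+1%:R * t ^+ k * (z - t) <= z ^+ k.+1.
Proof.
move=> t0 z0; elim: k => [|k IH]; first by rewrite !expr1 expr0; lra.
rewrite (exprS z); apply: le_trans (ler_wpM2l z0 IH).
rewrite -subr_ge0 -(natr1 k.+1) !exprS.
set p := t ^+ k; set n := k.+1%:R.
rewrite (_ : _ - _ = n * p * (z - t) ^+ 2); last by ring.
by rewrite mulr_ge0 ?sqr_ge0 // mulr_ge0 ?ler0n // exprn_ge0.
Qed.

(** Markov's inequality for a [k]-th power. By convexity, on the event the average [phi] of the
    powers of [Y i / b i], with weights [b i / B], is at least the [k]-th power of [expR 1], while
    its expectation is at most 1. Convexity plays the role of the triangle inequality for the
    [k]-norm. *)
Lemma sum_moments_tail (R : realType) (d : measure_display)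
    (T : measurableType d) (P : probability T R) (I : eqType) (s : seq I)
    (Y : I -> T -> R) (b : I -> R) (B : R) (k : nat) : (0 < k)%N ->
  (forall i, measurable_fun setT (Y i)) -> (forall i w, 0 <= Y i w) ->
  (forall i, 0 < b i) ->
  {in s, forall i, (\int[P]_w (Y i w ^+ k)%:E <= (b i ^+ k)%:E)%E} ->
  0 < B -> \sum_(i <- s) b i <= B ->
  (P [set w | (expR 1 * B <= \sum_(i <- s) Y i w)%R] <= (expR (- k%:R))%:E)%E.
Proof.
case: k => // k _ mY Y0 b0 Yb B0 sB; set e := expR 1.
have e0 : 0 < e by exact: expR_gt0.
(* Jensen for [z |-> z ^ k.+1] with weights [b i / B] at [z i = Y i / b i], in
   the form of the tangent line at [e]. *)
pose a i := b i / B / b i ^+ k.+1.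
have a0 i : 0 <= a i by rewrite !divr_ge0 ?exprn_ge0 ?ltW.
pose phi w := \sum_(i <- s) a i * Y i w ^+ k.+1.
have mphi : measurable_fun setT phi.
  apply: measurable_sum => i; apply: measurable_funM => //.
  exact: measurable_funX.
have phi0 w : 0 <= phi w.
  by apply: sumr_ge0 => i _; rewrite mulr_ge0 ?exprn_ge0.
set E := [set w | _].
have mE : measurable E.
  rewrite /E -[X in measurable X]setTI; apply: measurable_fun_ler => //.
  exact: measurable_sum.
have phiE w : E w -> e ^+ k.+1 <= phi w.
  rewrite /E/= => Ew; set L := (\sum_(i <- s) b i) / B.
  have L1 : L <= 1 by rewrite ler_pdivrMr ?mul1r.
  have SB : e <= (\sum_(i <- s) Y i w) / B by rewrite ler_pdivlMr.
  set S := _ / B in SB.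
  have step : e ^+ k.+1 * L + k.+1%:R * e ^+ k * (S - e * L) <= phi w.
    rewrite /L /S /phi !mulr_suml !mulr_sumr -sumrB mulr_sumr -big_split/=.
    apply: ler_sum => i _.
    have bi := b0 i.
    have := ler_tangent_exprn k (ltW e0) (divr_ge0 (Y0 i w) (ltW bi)).
    move=> /(ler_wpM2l (ltW (divr_gt0 bi B0))) tangent.
    rewrite (_ : a i * _ = b i / B * (Y i w / b i) ^+ k.+1); last first.
      by rewrite /a expr_div_n mulrA -!mulrA; congr (_ * (_ * _)); rewrite mulrC.
    apply: le_trans tangent; rewrite le_eqVlt; apply/orP; left; apply/eqP.
    by field; rewrite !gt_eqF.
  (* The weights have total [L <= 1], perhaps not 1. The missing part [e - e * L] is recovered from
     [S >= e], since the slope carries the factor [k.+1 >= 1]. *)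
  apply: le_trans step; rewrite exprS.
  have p0 : 0 < e ^+ k by exact: exprn_gt0.
  have k1 : (1 : R) <= k.+1%:R by rewrite ler1n.
  move: (e ^+ k) k.+1%:R p0 k1 => p n p0 n1.
  have : n * p * (e - e * L) <= n * p * (S - e * L).
    by rewrite ler_pM2l ?lerD2r// mulr_gt0// (lt_le_trans _ n1).
  have : p * (e - e * L) <= n * p * (e - e * L).
    by rewrite -mulrA ler_peMl// mulr_ge0 ?(ltW p0)// subr_ge0 ler_piMr ?(ltW e0).
  lra.
have Ephi : (\int[P]_w (phi w)%:E <= 1)%E.
  under eq_integral do rewrite /phi -sumEFin.
  rewrite ge0_integral_sum//; last 2 first.
  - move=> i; apply/measurable_EFinP; apply: measurable_funM => //.
    exact: measurable_funX.
  - by move=> i w _; rewrite lee_fin mulr_ge0 ?exprn_ge0.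
  apply: (@le_trans _ _ (\sum_(i <- s) (b i / B)%:E)%E).
    rewrite big_seq [leRHS]big_seq; apply: lee_sum => i si.
    under eq_integral do rewrite EFinM.
    rewrite ge0_integralZl_EFin//; last 2 first.
    - by move=> w _; rewrite lee_fin exprn_ge0.
    - by apply/measurable_EFinP; exact: measurable_funX.
    apply: le_trans (lee_wpmul2l _ (Yb i si)) _; first by rewrite lee_fin.
    by rewrite -EFinM /a divfK// expf_neq0// gt_eqF.
  by rewrite sumEFin lee_fin -mulr_suml ler_pdivrMr ?mul1r.
have : (\int[P]_(w in E) (e ^+ k.+1)%:E <= 1)%E.
  apply: le_trans Ephi; apply: (@le_trans _ _ (\int[P]_(w in E) (phi w)%:E)%E).
    apply: ge0_le_integral => //; first by move=> w _; rewrite lee_fin exprn_ge0 ?ltW.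
    by apply/measurable_EFinP; exact: measurable_funTS.
  apply: ge0_subset_integral => //; first exact/measurable_EFinP.
  by move=> w _; rewrite lee_fin.
rewrite integral_cst// muleC -lee_pdivlMr ?exprn_gt0// mul1e.
by rewrite /e -expRM_natl mulr1 expRN.
Qed.

Lemma moment_le_Lnorm (R : realType) (d : measure_display)
    (T : measurableType d) (P : probability T R) (f : T -> R) (k : nat) (M : R) :
  (0 < k)%N -> ('N[P]_(k%:R%:E) [EFin \o f] <= M%:E)%E ->
  (\int[P]_w (`|f w| ^+ k)%:E <= (M ^+ k)%:E)%E.
Proof.
move=> k0 fM; have kR : (k%:R : R) != 0 by rewrite pnatr_eq0 -lt0n.
have M0 : 0 <= M by rewrite -lee_fin (le_trans (Lnorm_ge0 _ _ _) fM).
rewrite -(powR_mulrn k M0) -poweR_EFin.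
under eq_integral do rewrite -powR_mulrn//.
under eq_integral do rewrite -poweR_EFin.
rewrite -[X in (X <= _)%E](powR_Lnorm P (EFin \o f) kR).
apply: gt0_ler_poweR; rewrite ?in_itv/= ?Lnorm_ge0 ?leey ?lee_fin ?ler0n ?M0//.
Qed.

(** Where the excess is positive, [x / c > 1], so extra factors [x / c] only increase the bound [x].
    This trades the threshold for higher powers of the increment, which decay faster with the
    level. *)
Lemma excess_le_exprn (R : realType) (c x : R) (r : nat) : 0 < c -> 0 <= x ->
  excess c x <= x ^+ r.+1 / c ^+ r.
Proof.
move=> c0 x0; have q0 : 0 <= x ^+ r.+1 / c ^+ r.
  by rewrite divr_ge0 ?exprn_ge0// ltW.
rewrite /excess ge_max q0 andbT; have [xc|cx] := leP x c.
  by rewrite (le_trans _ q0)// subr_le0.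
apply: (@le_trans _ _ x); first by rewrite lerBlDl lerDr ltW.
rewrite exprS -mulrA -expr_div_n ler_peMr// exprn_ege1//.
by rewrite ler_pdivlMr// mul1r ltW.
Qed.

Lemma moment_excess (R : realType) (d : measure_display)
    (T : measurableType d) (P : probability T R) (f : T -> R) (k r : nat)
    (c M : R) : measurable_fun setT f -> (0 < k)%N -> 0 < c ->
  ('N[P]_((r.+1 * k)%:R%:E) [EFin \o f] <= M%:E)%E ->
  (\int[P]_w (excess c `|f w| ^+ k)%:E <= ((M ^+ r.+1 / c ^+ r) ^+ k)%:E)%E.
Proof.
move=> mf k0 c0 /moment_le_Lnorm; rewrite muln_gt0 k0 => /(_ isT) fM.
have cr0 : 0 < (c ^+ r) ^- k by rewrite invr_gt0 !exprn_gt0.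
apply: (@le_trans _ _ (\int[P]_w ((c ^+ r) ^- k * `|f w| ^+ (r.+1 * k))%:E)%E).
  apply: ge0_le_integral => //.
  - by move=> w _; rewrite lee_fin exprn_ge0// excess_ge0.
  - apply/measurable_EFinP; apply: measurable_funX.
    apply: measurable_maxr => //; apply: measurable_funB => //.
    exact: measurableT_comp.
  - apply/measurable_EFinP; apply: measurable_funM => //.
    by apply: measurable_funX; exact: measurableT_comp.
  - move=> w _; rewrite lee_fin mulrC exprM -exprVn -exprMn.
    by rewrite lerXn2r ?nnegrE ?excess_ge0 ?excess_le_exprn// divr_ge0 ?exprn_ge0// ltW.
under eq_integral do rewrite EFinM.
rewrite ge0_integralZl_EFin ?(ltW cr0)//; last first.
  by apply/measurable_EFinP; apply: measurable_funX; exact: measurableT_comp.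
apply: le_trans (lee_wpmul2l _ fM) _; first by rewrite lee_fin ltW.
by rewrite -EFinM lee_fin mulrC exprM -exprVn -exprMn.
Qed.

Lemma moment_excess0 (R : realType) (d : measure_display)
    (T : measurableType d) (P : probability T R) (f : T -> R) (k : nat)
    (M : R) : (0 < k)%N -> ('N[P]_(k%:R%:E) [EFin \o f] <= M%:E)%E ->
  (\int[P]_w (excess 0 `|f w| ^+ k)%:E <= (M ^+ k)%:E)%E.
Proof.
move=> k0 fM; under eq_integral do rewrite /excess subr0 max_l//.
exact: moment_le_Lnorm.
Qed.

(** * Geometric sums and the choice of thresholds *)

Lemma ler_sum_split (R : realType) (F : nat -> R) (n0 N : nat) :
  (forall n, 0 <= F n) ->
  \sum_(n < N) F n <= \sum_(n < n0) F n + \sum_(j < N) F (n0 + j)%N.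
Proof.
move=> F0; have -> : \sum_(n < n0) F n + \sum_(j < N) F (n0 + j)%N =
    \sum_(n < n0 + N) F n by rewrite big_split_ord.
by rewrite addnC big_split_ord/= lerDl sumr_ge0.
Qed.

Lemma geometric_sum_le (R : realType) (x : R) (n : nat) : 0 <= x -> x < 1 ->
  \sum_(i < n) x ^+ i <= (1 - x)^-1.
Proof.
move=> x0 x1; have x1' : 0 < 1 - x by rewrite subr_gt0.
rewrite -[leRHS]mul1r ler_pdivlMr// mulrC.
have := subrX1 x n; have := exprn_ge0 n x0; lra.
Qed.

Lemma geometric_sum_gt1 (R : realType) (x : R) (n : nat) : 1 < x ->
  \sum_(i < n) x ^+ i <= x ^+ n / (x - 1).
Proof.
move=> x1; have x1' : 0 < x - 1 by rewrite subr_gt0.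
rewrite ler_pdivlMr// mulrC -subrX1; lra.
Qed.

Lemma bernoulli_exprn (R : realType) (e : R) (n : nat) : 0 <= e <= 1 ->
  1 - n%:R * e <= (1 - e) ^+ n.
Proof.
move=> /andP[e0 e1]; elim: n => [|n IH]; first by rewrite expr0; lra.
have e1' : 0 <= 1 - e by lra.
rewrite exprS; apply: le_trans (ler_wpM2l e1' IH).
have : 0 <= n%:R * e * e by rewrite !mulr_ge0.
by rewrite -natr1; lra.
Qed.

(* [m (2^-n)^q] is the size of the increments at level [n] and [n0] is the first
   level at which it drops below [c]. The coarser levels get threshold 0, the
   finer ones share [c / 2] geometrically; there the power [r.+1 > 1 / q] makes
   the bounds summable. *)
Lemma level_budget (R : realType) (q : R) : 0 < q -> q < 1 ->
  exists (K : R) (r : nat), 0 < K /\ forall m c : R, 0 < m -> 0 < c ->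
  exists w b : nat -> R, [/\ forall n, 0 <= w n, forall n, 0 < b n,
    forall N, 2 * (\sum_(n < N) w n) <= c,
    forall N, \sum_(n < N) 2 ^+ n * b n <= K * (c * (m / c) `^ (1 / q)) &
    forall n, let y := m * (2^-1 `^ q) ^+ n in
      (w n = 0 /\ b n = y) \/
      (0 < w n /\ b n = (r.+1%:R * y) ^+ r.+1 / w n ^+ r)].
Proof.
move=> q0 q1; set s := 1 / q; set x : R := 2^-1 `^ q.
have s1' : 1 < s by rewrite /s ltr_pdivlMr// mul1r.
have s1 := ltW s1'.
have x0 : 0 < x by rewrite powR_gt0.
have x1 : x < 1.
  rewrite /x -[ltRHS](_ : 1 `^ q = 1); last by rewrite powR1.
  by apply: gt0_ltr_powR; rewrite ?nnegrE//; lra.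
(* The power [s] turns the size factor [x ^+ n] of the increments of level [n] back into the
   interval length. *)
have xs n : (x ^+ n) `^ s = 2^-1 ^+ n.
  rewrite -powR_mulrn ?(ltW x0)// powRAC /x -(powRrM _ q) /s mul1r mulfV ?gt_eqF//.
  by rewrite powRr1 ?powR_mulrn.
(* As [q < 1], the coarse levels form a geometric sum of ratio above 1, controlled by its last
   term. *)
have x2 : 1 < 2 * x.
  have := xs 1; rewrite !expr1 -mulr_powRB1 ?(ltW x0)//; last by lra.
  have : x `^ (s - 1) < 1.
    rewrite -[ltRHS](_ : 1 `^ (s - 1) = 1); last by rewrite powR1.
    by apply: gt0_ltr_powR; rewrite ?nnegrE//; lra.
  by move=> /(fun h => mulr_gt0 x0 (etrans (subr_gt0 _ _) h)); lra.
(* With [r.+1 > 2 / q], the factor [x ^+ r.+1 <= 4^-1] per level beats the doubling of the number of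
   intervals. *)
pose r := Num.trunc (2 / q); set r1 : R := r.+1%:R.
have r1q : 2 / q <= r1 by apply: ltW; exact: truncnS_gt.
have sr1 : s <= r1 by apply: le_trans r1q; rewrite ler_pM2r ?invr_gt0//; lra.
have xr : x ^+ r.+1 <= 4^-1.
  rewrite -powR_mulrn ?(ltW x0)//; apply: (@le_trans _ _ (x `^ (s * 2))).
    by rewrite ger_powR ?x0 ?(ltW x1)// /s mul1r mulrC.
  by rewrite powRrM -[x in x `^ s]expr1 xs powR_mulrn// -exprM; lra.
have r1ge1 : 1 <= r1 by rewrite ler1n.
have r10 : 0 < r1 by lra.
(* The thresholds decay with ratio [rho], so near 1 that Bernoulli's inequality gives
   [rho ^+ r >= 3 / 4]. The fine levels then have ratio at most [2 / 3], whose geometric sum is the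
   3 in the constant below. *)
pose e := (4 * r1)^-1; pose rho : R := 1 - e.
have /andP[e0 e1] : 0 < e <= 4^-1.
  by rewrite /e invr_gt0 mulr_gt0//= lef_pV2 ?posrE ?mulr_gt0// ler_peMr.
have rho0 : 0 < rho by rewrite /rho; lra.
have rho1 : rho < 1 by rewrite /rho; lra.
have rhor : 3 / 4 <= rho ^+ r.
  apply: le_trans (@bernoulli_exprn R _ r _); last by lra.
  rewrite lerBrDr -lerBrDl (_ : 1 - 3 / 4 = 4^-1); last by lra.
  rewrite ler_pdivrMr ?mulr_gt0// mulrA mulVf ?mul1r// ler_nat.
  exact: leqnSn.
pose K1 := 2 * x / (2 * x - 1); pose K2 := r1 ^+ r.+1 * (8 * r1) ^+ r.
have K10 : 0 < K1 by rewrite divr_gt0 ?mulr_gt0// subr_gt0.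
have K20 : 0 < K2 by rewrite mulr_gt0 // exprn_gt0 // mulr_gt0.
exists (K1 + 3 * K2), r; split; first by rewrite addr_gt0 // mulr_gt0.
move=> m c m0 c0.
have [n0 /andP[mn0 n0min]] : exists n0, (m * x ^+ n0 <= c) &&
    ((n0 == 0%N) || (c < m * x ^+ n0.-1)).
  have ex : exists n, m * x ^+ n <= c.
    have : `|x| < 1 by rewrite ger0_norm ?ltW.
    move=> /(cvg_geometric m)/cvgrPdist_le/(_ c c0)/filter_ex[n].
    rewrite sub0r normrN => H; exists n.
    exact: le_trans (ler_norm _) H.
  have := ex_minnP ex; case=> n Pn nmin; exists n; rewrite Pn/=.
  case: n Pn nmin => // n _ nmin; rewrite orFb/= ltNge; apply/negP => /nmin.
  by rewrite ltnn.
set A := m / c; have A0 : 0 < A by rewrite divr_gt0.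
have cA : m = c * A by rewrite /A mulrC divfK// gt_eqF.
(* Since [(1 - rho)^-1 = 4 * r1], the prefactor [c / (8 * r1)] makes the thresholds add up to at
   most [c / 2]. *)
pose w n := if (n < n0)%N then 0 else c / (8 * r1) * rho ^+ (n - n0).
pose b n := if (n < n0)%N then m * x ^+ n
  else (r1 * (m * x ^+ n)) ^+ r.+1 / w n ^+ r.
have w0 n : 0 <= w n.
  by rewrite /w; case: ifP => // _; rewrite mulr_ge0 ?exprn_ge0 ?divr_ge0 ?mulr_ge0 ?ltW.
have wp n : (n0 <= n)%N -> 0 < w n.
  by rewrite /w ltnNge => ->/=; rewrite mulr_gt0 ?exprn_gt0 ?divr_gt0 ?mulr_gt0.
have b0 n : 0 < b n.
  rewrite /b; case: ltnP => nn0; first by rewrite mulr_gt0 ?exprn_gt0.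
  by rewrite divr_gt0 ?exprn_gt0 ?wp// !mulr_gt0 ?exprn_gt0.
exists w, b; split => //.
- move=> N; have := @ler_sum_split R w n0 N w0.
  have -> : \sum_(i < n0) w i = 0 by apply: big1 => i _; rewrite /w ltn_ord.
  rewrite add0r.
  under [X in _ <= X -> _]eq_bigr do rewrite /w ltnNge leq_addr/= addKn.
  rewrite -mulr_sumr => H; have G := @geometric_sum_le R rho N (ltW rho0) rho1.
  have rhoE : (1 - rho)^-1 = 4 * r1 by rewrite /rho subKr invrK.
  rewrite rhoE in G.
  have c8 : 0 <= c / (8 * r1) by rewrite divr_ge0 ?mulr_ge0 ?ltW.
  have := ler_wpM2l c8 G.
  have -> : c / (8 * r1) * (4 * r1) = c / 2 by field; rewrite gt_eqF.
  by move=> /(le_trans H); lra.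
- move=> N; have F0 n : 0 <= 2 ^+ n * b n by rewrite mulr_ge0 ?exprn_ge0 ?ltW.
  apply: le_trans (@ler_sum_split R (fun n => 2 ^+ n * b n) n0 N F0) _.
  rewrite mulrDl; apply: lerD.
    under eq_bigr do rewrite /b ltn_ord mulrCA -exprMn.
    rewrite -mulr_sumr.
    have [n00|n00] := eqVneq n0 0%N.
      rewrite n00 big_ord0 mulr0; apply: mulr_ge0; first exact: ltW.
      by rewrite pmulr_rge0// powR_ge0.
    rewrite (negbTE n00)/= in n0min; move: n00 n0min; case: (n0) => // n1 _ /= cm.
    apply: le_trans (ler_wpM2l (ltW m0) (geometric_sum_gt1 n1.+1 x2)) _.
    rewrite exprS (_ : m * _ = K1 * (c * (2 ^+ n1 * (A * x ^+ n1)))); last first.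
      by rewrite /K1 exprMn [in LHS]cA; field; rewrite gt_eqF// subr_gt0.
    rewrite !ler_pM2l//.
    (* At the last coarse level the increment size still exceeds [c], so raising [A * x ^+ n1] to
       the power [s >= 1] increases it; then [2 ^+ n1] cancels and only the power [s] of [A]
       remains. *)
    have v1 : 1 <= A * x ^+ n1.
      by rewrite /A mulrAC ler_pdivlMr// mul1r ltW.
    apply: le_trans (ler_wpM2l _ (le1r_powR v1 s1)) _; first exact: exprn_ge0.
    rewrite powRM ?exprn_ge0 ?(ltW x0) ?(ltW A0)// xs mulrCA -exprMn divff ?expr1n ?mulr1//.
  set v := A * x ^+ n0.
  have v0 : 0 < v by rewrite mulr_gt0 ?exprn_gt0.
  have v1 : v <= 1 by rewrite /v /A mulrAC ler_pdivrMr// mul1r.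
  (* The same cancellation from the other side: [v <= 1] and [s <= r.+1], so lowering the exponent
     to [s] increases the power. *)
  have vA : 2 ^+ n0 * v ^+ r.+1 <= A `^ s.
    have : v ^+ r.+1 <= v `^ s.
      by rewrite -powR_mulrn ?ger_powR ?v0 ?(ltW v0).
    move=> /(ler_wpM2l (exprn_ge0 n0 (ler0n R 2))) /le_trans; apply.
    rewrite powRM ?exprn_ge0 ?(ltW x0) ?(ltW A0)// xs mulrCA -exprMn divff ?expr1n ?mulr1//.
  have term j : 2 ^+ (n0 + j) * b (n0 + j)%N =
      K2 * (c * (2 ^+ n0 * v ^+ r.+1)) * (2 * x ^+ r.+1 / rho ^+ r) ^+ j.
    rewrite /b /w ltnNge leq_addr/= addKn !exprD.
    rewrite /K2 /v cA !(exprMn, exprVn) (exprAC x r.+1) (exprAC rho r) (exprS c).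
    have c8 : (8%:R : R) ^+ r != 0 by rewrite expf_neq0.
    by field; rewrite c8 !expf_neq0 ?gt_eqF.
  under eq_bigr do rewrite term.
  rewrite -mulr_sumr; set rt := 2 * _ / _.
  have rt0 : 0 <= rt by rewrite divr_ge0 ?mulr_ge0 ?exprn_ge0 ?ltW.
  have rt1 : rt <= 2 / 3.
    rewrite ler_pdivrMr ?exprn_gt0//; lra.
  have rt1' : rt < 1 by lra.
  have gs : \sum_(i < N) rt ^+ i <= 3.
    apply: le_trans (geometric_sum_le N rt0 rt1') _.
    by rewrite -[leRHS]invrK lef_pV2 ?posrE; lra.
  rewrite [leLHS]mulrC; apply: le_trans (ler_wpM2r _ gs) _.
    apply: ltW; apply: mulr_gt0 => //; apply: mulr_gt0 => //.
    by apply: mulr_gt0; rewrite exprn_gt0.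
  rewrite -[leRHS]mulrA; apply: ler_wpM2l => //; apply: ler_wpM2l; first exact: ltW.
  by apply: ler_wpM2l => //; exact: ltW.
- move=> n; rewrite /b; case: ifPn => nn0; [left|right]; split => //.
    by rewrite /w nn0.
  by rewrite wp// leqNgt.
Qed.

(** * Reduction of arbitrary subdivisions to dyadic ones *)

Lemma truncated_variation_onE (R : realType) (c a b : R) (f : R -> R)
    (s : seq R) : truncated_variation_on c a b f s = tv_sum c f a s.
Proof.
rewrite /truncated_variation_on.
elim: s a => [|x s IH] a /=; first by rewrite big_geq.
by rewrite big_nat_recl//= -IH.
Qed.

Lemma tv_sum_map (R : realType) (T U : Type) (g : T -> U) (c : R) (h : U -> R)
    (a : T) (s : seq T) :
  tv_sum c h (g a) (map g s) = tv_sum c (h \o g) a s.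
Proof. by elim: s a => //= b s IH a; rewrite IH. Qed.

Lemma cvg_excess (R : realType) (c : R) (u : R ^nat) (l : R) :
  u @ \oo --> l -> excess c (u n) @[n --> \oo] --> excess c l.
Proof.
move=> ul; rewrite /excess maxr_absE addr0 subr0.
under eq_fun do rewrite maxr_absE addr0 subr0.
have uc : u n - c @[n --> \oo] --> l - c by apply: cvgB => //; exact: cvg_cst.
apply: cvgM; last exact: cvg_cst.
by apply: cvgD => //; exact: cvg_norm.
Qed.

Lemma cvg_tv_sum (R : realType) (T : eqType) (c : R) (h : nat -> T -> R)
    (l : T -> R) (a : T) (s : seq T) :
  {in a :: s, forall t, h n t @[n --> \oo] --> l t} ->
  tv_sum c (h n) a s @[n --> \oo] --> tv_sum c l a s.
Proof.
elim: s a => [|b s IH] a hl /=; first exact: cvg_cst.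
apply: cvgD; last by apply: IH => t ts; apply: hl; rewrite inE ts orbT.
apply: cvg_excess; apply: cvg_norm; apply: cvgB; apply: hl.
  by rewrite !inE eqxx orbT.
by rewrite inE eqxx.
Qed.

Definition dyadic (R : realType) (N j : nat) : R := j%:R / 2 ^+ N.

(** Rounding goes up so that the dyadic points approach [t] from the right, the side on which a
    càdlàg path is continuous. *)
Definition dyadic_ceil (R : realType) (N : nat) (t : R) : nat :=
  `|Num.ceil (2 ^+ N * t)|%N.

Section dyadic_ceil_theory.
Context {R : realType}.
Implicit Types (t : R) (N : nat).

Let pow2_gt0 N : 0 < (2 : R) ^+ N. Proof. by rewrite exprn_gt0. Qed.

Lemma dyadic_ceilE N t : 0 <= t ->
  (dyadic_ceil N t)%:R = (Num.ceil (2 ^+ N * t))%:~R :> R.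
Proof.
move=> t0; rewrite /dyadic_ceil natr_absz ger0_norm// ceil_ge0.
by rewrite (lt_le_trans (ltrN10 _))// mulr_ge0// ltW.
Qed.

Lemma dyadic_ceil_ge N t : 0 <= t -> t <= dyadic R N (dyadic_ceil N t).
Proof.
by move=> t0; rewrite /dyadic ler_pdivlMr// dyadic_ceilE// mulrC ceil_ge.
Qed.

Lemma dyadic_ceil_lt N t : 0 <= t ->
  (dyadic_ceil N t)%:R < 2 ^+ N * t + 1.
Proof.
move=> t0; rewrite dyadic_ceilE//.
by have := ceilB1_lt (2 ^+ N * t); rewrite intrB ltrBlDr.
Qed.

Lemma dyadic_ceil_le N t : 0 <= t ->
  dyadic R N (dyadic_ceil N t) <= t + 2^-1 ^+ N.
Proof.
move=> t0; rewrite /dyadic ler_pdivrMr// mulrDl -exprMn mulVf// expr1n mulrC.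
exact/ltW/dyadic_ceil_lt.
Qed.

Lemma dyadic_ceil0 N : dyadic_ceil N (0 : R) = 0%N.
Proof. by rewrite /dyadic_ceil mulr0 ceil0. Qed.

Lemma dyadic_ceil1 N : dyadic_ceil N (1 : R) = (2 ^ N)%N.
Proof.
rewrite /dyadic_ceil mulr1 -natrX (_ : (2 ^ N)%:R = (2 ^ N)%:Z%:~R)//.
by rewrite intrKceil.
Qed.

(** Rounding moves a point by less than the mesh, so distinct points stay distinct once the mesh is
    at most [b - a]. *)
Lemma dyadic_ceil_homo_near (a b : R) : 0 <= a -> a < b ->
  \forall N \near \oo, (dyadic_ceil N a < dyadic_ceil N b)%N.
Proof.
move=> a0 ab; have b0 : 0 <= b by rewrite (le_trans a0)// ltW.
have h1 : `|2^-1 : R| < 1 by rewrite ger0_norm; lra.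
have ba : 0 < b - a by rewrite subr_gt0.
have := cvg_geometric 1 h1 => /cvgrPdist_le/(_ _ ba); apply: filterS => N.
rewrite sub0r normrN /geometric /= mul1r ger0_norm ?exprn_ge0 ?invr_ge0//.
move=> H; rewrite -(ltr_nat R); apply: lt_le_trans (dyadic_ceil_lt N a0) _.
have /= := dyadic_ceil_ge N b0; rewrite /dyadic ler_pdivlMr// => /(le_trans _).
apply; have := ler_wpM2l (ltW (pow2_gt0 N)) H.
by rewrite -exprMn mulfV// expr1n; lra.
Qed.

Lemma dyadic_ceil_path_near (a : R) (s : seq R) : 0 <= a -> path <%R a s ->
  \forall N \near \oo, path ltn (dyadic_ceil N a) (map (dyadic_ceil N) s).
Proof.
elim: s a => [|b s IH] a a0 /=; first by move=> _; near=> N.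
move=> /andP[ab pth].
have b0 : 0 <= b by rewrite (le_trans a0)// ltW.
have := IH _ b0 pth; apply: filterS2 (dyadic_ceil_homo_near a0 ab) => N.
by move=> -> ->.
Unshelve. all: end_near.
Qed.

(** Right continuity gives the limit for [t < 1]. At [t = 1], where no right limit is available,
    rounding is exact and the sequence is constant. *)
Lemma cvg_dyadic_ceil (f : R -> R) t : cadlag 0 1 f -> 0 <= t <= 1 ->
  f (dyadic R N (dyadic_ceil N t)) @[N --> \oo] --> f t.
Proof.
move=> [fr _] /andP[t0]; rewrite le_eqVlt => /predU1P[->|t1].
  under eq_fun do rewrite dyadic_ceil1 /dyadic natrX divff ?expf_neq0//.
  exact: cvg_cst.
(* The limit must also allow the value [t] itself, since a rounded point may equal [t]. *)
have ft := cvg_at_right_within (fr t (introT andP (conj t0 t1))).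
have h1 : `|2^-1 : R| < 1 by rewrite ger0_norm; lra.
have gt : dyadic R N (dyadic_ceil N t) @[N --> \oo] --> t.
  apply: (@squeeze_cvgr _ _ _ _ (cst t) (fun N => t + 2^-1 ^+ N)).
  - by near=> N; rewrite dyadic_ceil_ge// dyadic_ceil_le.
  - exact: cvg_cst.
  - rewrite -[X in _ --> X]addr0; apply: cvgD; first exact: cvg_cst.
    exact: cvg_expr.
apply: cvg_comp ft => A; rewrite /within/= => /gt tA.
apply: (@filterS nat \oo _ _ _ _ tA) => N /=; apply.
exact: dyadic_ceil_ge.
Unshelve. all: end_near.
Qed.

End dyadic_ceil_theory.

Definition dyadic_partition (N : nat) (s : seq nat) : bool :=
  path ltn 0 s && (last 0 s == 2 ^ N)%N.

Lemma path_lt_le_last (R : realType) (a : R) (s : seq R) : path <%R a s ->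
  {in a :: s, forall t, t <= last a s}.
Proof.
elim: s a => [|b s IH] a /=; first by move=> _ t; rewrite inE => /eqP->.
move=> /andP[ab pth] t; rewrite inE => /predU1P[->|]; last exact: IH.
by rewrite (le_trans (ltW ab))// IH// mem_head.
Qed.

(** A strict inequality for one subdivision survives rounding its points at a fine enough level,
    because the finite sum converges. The resulting condition ranges over countably many pairs
    [(N, s)], which also yields measurability. *)
Lemma lt_truncated_variation_dyadic (R : realType) (c y : R) (f : R -> R) :
  cadlag 0 1 f ->
  ((y%:E < truncated_variation c 0 1 f)%E <->
   exists N s, dyadic_partition N s /\ y < tv_sum c (f \o dyadic R N) 0%N s).
Proof.
move=> cf; split.
  move=> /ereal_sup_gt[_ [s [pth /eqP lst] <-]].
  rewrite lte_fin truncated_variation_onE => ys.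
  have s01 : {in 0 :: s, forall t : R, 0 <= t <= 1}.
    move=> t ts; apply/andP; split.
      move: ts; rewrite inE => /predU1P[->//|ts].
      by apply: ltW; have /allP := lt_path_min pth; exact.
    by rewrite -lst path_lt_le_last.
  have cv := @cvg_tv_sum R _ c (fun N => f \o dyadic R N \o dyadic_ceil N) f 0 s
    (fun t ts => cvg_dyadic_ceil cf (s01 t ts)).
  have /filter_ex[N [yN pN]] : \forall N \near \oo,
      y < tv_sum c (f \o dyadic R N \o dyadic_ceil N) 0 s /\
      path ltn (dyadic_ceil N (0 : R)) (map (dyadic_ceil N) s).
    apply: filterI; last exact: dyadic_ceil_path_near.
    exact: (cvgr_gt _ cv).
  exists N, (map (dyadic_ceil N) s); split.
    move: pN; rewrite dyadic_ceil0 /dyadic_partition => ->/=; apply/eqP.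
    rewrite -[X in last X _](dyadic_ceil0 (R := R) N).
    by rewrite last_map lst dyadic_ceil1.
  by rewrite -[0%N](dyadic_ceil0 (R := R) N) tv_sum_map.
move=> [N [s [/andP[pth /eqP lst] ys]]].
have pw : 0 < (2 : R) ^+ N by rewrite exprn_gt0.
have d0 : dyadic R N 0 = 0 by rewrite /dyadic mul0r.
apply: (@lt_le_trans _ _ (tv_sum c (f \o dyadic R N) 0%N s)%:E) => //.
apply: ereal_sup_ubound; exists (map (dyadic R N) s).
  split.
    rewrite -d0 path_map; apply: sub_path pth => i j ij /=.
    by rewrite /dyadic ltr_pM2r ?invr_gt0// ltr_nat.
  by rewrite -d0 last_map lst /dyadic natrX divff// gt_eqF.
by rewrite truncated_variation_onE -d0 tv_sum_map.
Qed.

(** * Measurability of the truncated variation *)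

Lemma measurable_tv_sum (R : realType) (d : measure_display)
    (T : measurableType d) (I : Type) (c : R) (X : I -> T -> R) (a : I)
    (s : seq I) : (forall i, measurable_fun setT (X i)) ->
  measurable_fun setT (fun w => tv_sum c (X ^~ w) a s).
Proof.
move=> mX; elim: s a => [|b s IH] a /=; first exact: measurable_cst.
apply: measurable_funD => //; apply: measurable_maxr => //.
apply: measurable_funB => //; apply: measurableT_comp => //.
exact: measurable_funB.
Qed.

Lemma measurable_lt_truncated_variation (R : realType) (d : measure_display)
    (T : measurableType d) (X : R -> T -> R) (c y : R) :
  (forall t, measurable_fun setT (X t)) ->
  (forall w, cadlag 0 1 (X ^~ w)) ->
  measurable [set w | (y%:E < truncated_variation c 0 1 (X ^~ w))%E].
Proof.
move=> mX cX.
pose V (z : nat * seq nat) w := tv_sum c (fun j => X (dyadic R z.1 j) w) 0%N z.2.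
have -> : [set w | (y%:E < truncated_variation c 0 1 (X ^~ w))%E] =
    \bigcup_z [set w | dyadic_partition z.1 z.2 && (y < V z w)].
  apply/seteqP; split => w /=.
    move=> /(lt_truncated_variation_dyadic c y (cX w))[N [s [Ns yV]]].
    by exists (N, s) => //=; apply/andP.
  move=> [[N s] _ /= /andP[Ns yV]].
  by apply/(lt_truncated_variation_dyadic c y (cX w)); exists N, s.
apply: countable_bigcupT_measurable => // z.
case: (dyadic_partition _ _) => /=; last first.
  rewrite (_ : [set _ | _] = set0); first exact: measurable0.
  by apply/seteqP; split.
rewrite -[X in measurable X]setTI; apply: measurable_fun_ltr => //.
by apply: measurable_tv_sum => j; exact: mX.
Qed.

Lemma measurable_le_truncated_variation (R : realType) (d : measure_display)
    (T : measurableType d) (X : R -> T -> R) (c x : R) :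
  (forall t, measurable_fun setT (X t)) ->
  (forall w, cadlag 0 1 (X ^~ w)) ->
  measurable [set w | (x%:E <= truncated_variation c 0 1 (X ^~ w))%E].
Proof.
move=> mX cX.
have -> : [set w | (x%:E <= truncated_variation c 0 1 (X ^~ w))%E] =
  \bigcap_n [set w | ((x - n.+1%:R^-1)%:E < truncated_variation c 0 1 (X ^~ w))%E].
  apply/seteqP; split => w /=.
    move=> xT n _ /=; apply: lt_le_trans xT.
    by rewrite lte_fin ltrBlDr ltrDl invr_gt0.
  move=> H; apply/lee_subgt0Pr => e e0.
  have [n ne] : exists n, n.+1%:R^-1 < e.
    by exists (Num.trunc e^-1); rewrite invf_plt ?posrE// truncnS_gt.
  rewrite -EFinB; apply: le_trans (ltW (H n I)).
  by rewrite lee_fin lerD2l lerN2 ltW.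
by apply: bigcapT_measurable => n; exact: measurable_lt_truncated_variation.
Qed.

(** * The sum of excesses over all dyadic intervals and its tail *)

(** Levels are counted from the coarsest one, in reverse of [dyadic_excess], so that raising [N]
    only adds terms. *)
Definition level_excess (R : realType) (w : nat -> R) (f : R -> R) (N : nat) : R :=
  \sum_(n < N.+1) \sum_(i < 2 ^ n)
    excess (w n) `|f (dyadic R n i.+1) - f (dyadic R n i)|.

Lemma level_excess_nondecreasing (R : realType) (w : nat -> R) (f : R -> R) :
  nondecreasing_seq (level_excess w f).
Proof.
apply/nondecreasing_seqP => N; rewrite /level_excess [leRHS]big_ord_recr/= lerDl.
by apply: sumr_ge0 => i _; exact: excess_ge0.
Qed.

Lemma tv_sum_le_level_excess (R : realType) (c : R) (w : nat -> R) (f : R -> R)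
    (N : nat) (s : seq nat) : (forall n, 0 <= w n) ->
  2 * (\sum_(n < N.+1) w n) <= c -> dyadic_partition N s ->
  tv_sum c (f \o dyadic R N) 0%N s <= level_excess w f N.
Proof.
move=> w0 wc /andP[pth /eqP lst].
have revE (m : 'I_N.+1) : (N - rev_ord m)%N = m.
  by rewrite /= subSS subKn// -ltnS ltn_ord.
have wc' : 2 * (\sum_(m < N.+1) w (N - m)%N) <= c.
  rewrite (reindex_inj rev_ord_inj)/=.
  by under eq_bigr do rewrite -[(N - _)%N]/(N - rev_ord _)%N revE.
apply: le_trans (tv_sum_dyadic (f \o dyadic R N) (fun m => w0 (N - m)%N) wc'
  (sub_path (@ltnW) pth) _) _; first by rewrite lst.
rewrite lst /dyadic_excess (reindex_inj rev_ord_inj)/= /level_excess.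
apply: ler_sum => n _.
rewrite -[(N.+1 - n.+1)%N]/(rev_ord n : nat) revE big_mkcond/=.
apply: ler_sum => i _; case: ifPn => [_|_]; last exact: excess_ge0.
have dE j : dyadic R N (j * 2 ^ (N.+1 - n.+1)) = dyadic R n j.
  rewrite subSS /dyadic; have nN : (n <= N)%N by rewrite -ltnS ltn_ord.
  rewrite -[in X in _ / X](subnK nN) exprD natrM natrX.
  by field; rewrite !expf_neq0.
by rewrite !dE.
Qed.

(** The moment tail bound is applied to the family of all pairs [(n, i)]; the [2 ^ n] intervals of
    level [n] share the bound [b n], whence the weighted sum. *)
Lemma level_excess_tail (R : realType) (C1 p q : R) (d : measure_display)
    (T : measurableType d) (P : probability T R) (X : R -> T -> R)
    (k r : nat) (w b : nat -> R) (B : R) (N : nat) :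
  0 < C1 -> 0 < p -> p <= 1 -> 0 < q -> (0 < k)%N ->
  (forall t, measurable_fun setT (X t)) ->
  (forall (k : nat) (s t : R), (1 <= k)%N -> 0 <= s <= 1 -> 0 <= t <= 1 ->
    ('N[P]_(k%:R%:E) [EFin \o (fun w => X t w - X s w)%R]
      <= (C1 * k%:R `^ p * `|s - t| `^ q)%:E)%E) ->
  (forall n, 0 < b n) -> 0 < B -> \sum_(n < N.+1) 2 ^+ n * b n <= B ->
  (forall n, let y := C1 * k%:R `^ p * (2^-1 `^ q) ^+ n in
      (w n = 0 /\ b n = y) \/
      (0 < w n /\ b n = (r.+1%:R * y) ^+ r.+1 / w n ^+ r)) ->
  (P [set z | (expR 1 * B <= level_excess w (X ^~ z) N)%R]
    <= (expR (- k%:R))%:E)%E.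
Proof.
move=> C10 p0 p1 q0 k0 mX XL b0 B0 bB wb.
pose J : seq (nat * nat) :=
  [seq (n, i) | n <- index_iota 0 N.+1, i <- index_iota 0 (2 ^ n)].
pose inc (z : nat * nat) v := X (dyadic R z.1 z.2.+1) v - X (dyadic R z.1 z.2) v.
pose Y z v := excess (w z.1) `|inc z v|.
have sumJ (F : nat * nat -> R) :
    \sum_(z <- J) F z = \sum_(n < N.+1) \sum_(i < 2 ^ n) F (n : nat, i : nat).
  by rewrite big_allpairs_dep big_mkord; apply: eq_bigr => n _; rewrite big_mkord.
have -> : [set z | (expR 1 * B <= level_excess w (X ^~ z) N)%R] =
    [set v | (expR 1 * B <= \sum_(z <- J) Y z v)%R].
  by apply/seteqP; split => v /=; rewrite sumJ.
have minc z : measurable_fun setT (inc z) by exact: measurable_funB.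
apply: (@sum_moments_tail R d T P _ J Y (fun z => b z.1)) => //.
- move=> z; apply: measurable_maxr => //; apply: measurable_funB => //.
  exact: measurableT_comp.
- by move=> z v; exact: excess_ge0.
- move=> [n i] /allpairsPdep[n' [i' [_ + [-> ->]]]].
  rewrite mem_index_iota /Y/= => lti.
  have d01 j : (j <= 2 ^ n')%N -> 0 <= dyadic R n' j <= 1.
    move=> jn; rewrite /dyadic divr_ge0 ?exprn_ge0//= ler_pdivrMr ?exprn_gt0//.
    by rewrite mul1r -natrX ler_nat.
  have dq : `|dyadic R n' i' - dyadic R n' i'.+1| `^ q = (2^-1 `^ q) ^+ n'.
    rewrite /dyadic -mulrBl -natr1 opprD addrA subrr sub0r mulN1r normrN.
    rewrite -exprVn ger0_norm ?exprn_ge0// -!powR_mulrn ?powR_ge0//.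
    by rewrite powRAC.
  have XN l : (0 < l)%N -> ('N[P]_(l%:R%:E) [EFin \o inc (n', i')] <=
      (C1 * l%:R `^ p * (2^-1 `^ q) ^+ n')%:E)%E.
    by move=> l0; rewrite -dq; apply: XL => //; apply: d01 => //; exact: ltnW.
  have [[-> ->]|[wn ->]] := wb n'; first by apply: moment_excess0 => //; exact: XN.
  apply: moment_excess => //; apply: le_trans (XN _ _) _; first by rewrite muln_gt0.
  (* The moment of order [r.+1 * k] brings the power [p] of [r.+1], which is at most [r.+1] because
     [p <= 1]. This keeps the constants independent of [p]. *)
  rewrite lee_fin natrM powRM// mulrA; set y := (2^-1 `^ q) ^+ n'.
  rewrite [leRHS](_ : _ = C1 * r.+1%:R * k%:R `^ p * y); last by ring.
  rewrite ler_wpM2r ?exprn_ge0 ?powR_ge0// ler_wpM2r ?powR_ge0//.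
  rewrite ler_wpM2l ?(ltW C10)//.
  by rewrite ler1_powR// ler1n.
- rewrite sumJ; apply: le_trans bB; apply: ler_sum => n _ /=.
  by rewrite sumr_const card_ord -[leLHS]mulr_natl natrX.
Qed.

(** The events increase with [N], so continuity from below carries the uniform bound over to their
    union. *)
Lemma level_excess_cvg_tail (R : realType) (d : measure_display)
    (T : measurableType d) (P : probability T R) (X : R -> T -> R)
    (w : nat -> R) (y e : R) : (forall t, measurable_fun setT (X t)) ->
  (forall N, (P [set z | (y <= level_excess w (X ^~ z) N)%R] <= e%:E)%E) ->
  let E := \bigcup_N [set z | (y <= level_excess w (X ^~ z) N)%R] in
  measurable E /\ (P E <= e%:E)%E.
Proof.
move=> mX Pe E.
have mF N : measurable [set z | (y <= level_excess w (X ^~ z) N)%R].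
  rewrite -[X in measurable X]setTI; apply: measurable_fun_ler => //.
  apply: measurable_sum => n; apply: measurable_sum => i.
  apply: measurable_maxr => //; apply: measurable_funB => //.
  by apply: measurableT_comp => //; exact: measurable_funB.
have mE : measurable E by exact: bigcupT_measurable.
split => //.
have cv := nondecreasing_cvg_mu (mu := P) mF mE.
rewrite -(cvg_lim _ (cv _))//; last first.
  move=> n m nm; apply/subsetPset => z /= /le_trans; apply.
  exact: level_excess_nondecreasing.
apply: lime_le; last exact: nearW.
apply: cvgP; apply: cv => n m nm; apply/subsetPset => z /= /le_trans; apply.
exact: level_excess_nondecreasing.
Qed.

(** * Choice of the moment order and the final tail bound *)

Theorem corollary1 (R : realType) (C1 q : R) (hC1 : 0 < C1)
    (hq0 : 0 < q) (hq1 : q < 1) :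
  exists D : R, 0 < D /\
    forall (p : R), 0 < p -> p <= 1 ->
    forall (d : measure_display) (T : measurableType d) (P : probability T R)
      (X : R -> {RV P >-> R}),
      (forall w : T, cadlag 0 1 (fun t => X t w)) ->
      (forall (k : nat) (s t : R), (1 <= k)%N ->
        0 <= s <= 1 -> 0 <= t <= 1 ->
        ('N[P]_(k%:R%:E) [EFin \o (fun w => X t w - X s w)%R]
          <= (C1 * k%:R `^ p * `|s - t| `^ q)%:E)%E) ->
      forall c u : R, 0 < c -> 1 <= u ->
        (P [set w | (D * u * c `^ (1 - 1 / q))%:E
                      <= truncated_variation c 0 1 (fun t => X t w)]
          <= (expR (- (u `^ (q / p))))%:E)%E.
Proof.
have [K [r [K0 budget]]] := level_budget hq0 hq1.
set s := 1 / q in budget *; have s0 : 0 < s by rewrite divr_gt0.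
(* Only [C1] and [q] enter, and [p] comes later. [expR 1] comes from the moment tail bound, [K] from
   the budget, the 2 next to [C1] from [k%:R <= 2 * U], and the leading 2 gives room for a strict
   inequality at [x / 2]. *)
exists (2 * (expR 1 * (K * (2 * C1) `^ s))); split.
  by rewrite !mulr_gt0 ?expR_gt0 ?powR_gt0 ?mulr_gt0.
move=> p p0 p1 d T P X cX XL c u c0 u1; set x := _ * u * _.
have u0 : 0 < u by lra.
set U := u `^ (q / p); have U1 : 1 <= U.
  by rewrite /U -[leLHS](powRr0 u) ler_powR// divr_ge0 ?ltW.
(* [U < k] gives the exponent in the tail, and [k <= 2 * U], valid as [U >= 1], keeps the moments of
   order [u]. *)
pose k := (Num.trunc U).+1.
have Uk : U < k%:R by exact: truncnS_gt.
have k2U : k%:R <= 2 * U.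
  have U0 : 0 <= U by lra.
  by have := truncn_le U; rewrite U0 /k -natr1; lra.
have m0 : 0 < C1 * k%:R `^ p by rewrite mulr_gt0 ?powR_gt0 ?ltr0n.
have [w [b [w0 b0 wc bK wb]]] := budget _ c m0 c0.
set B := K * _ in bK.
have B0 : 0 < B by rewrite !mulr_gt0 ?powR_gt0 ?divr_gt0.
have Bx : expR 1 * B <= x / 2.
  have -> : x / 2 = expR 1 * (K * ((2 * C1) `^ s * u * c `^ (1 - s))).
    by rewrite /x; field.
  (* The exponents [q / p] and [p * s] cancel, so [U] contributes exactly [u]; the factor 2 keeps
     exponent [p * s <= s]. *)
  have kU : (k%:R `^ p) `^ s <= 2 `^ s * u.
    rewrite -powRrM; apply: (@le_trans _ _ ((2 * U) `^ (p * s))).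
      have ps0 : 0 <= p * s by apply: mulr_ge0; exact: ltW.
      by apply: (ge0_ler_powR ps0); rewrite // nnegrE // pmulr_rge0 // powR_ge0.
    rewrite powRM ?powR_ge0// /U -powRrM.
    rewrite (_ : q / p * (p * s) = 1); last by rewrite /s; field; rewrite !gt_eqF.
    rewrite powRr1 ?(ltW u0)// ler_pM2r// ler_powR ?ler1n//.
    by rewrite ler_piMl// ltW.
  have cs : c^-1 `^ s = (c `^ s)^-1.
    by rewrite -powR_inv1 ?(ltW c0)// powRAC powR_inv1 ?powR_ge0.
  have cB : c `^ (1 - s) = c * (c `^ s)^-1.
    by rewrite powRB ?(gt_eqF c0) ?implybT// powRr1// ltW.
  have cs0 : 0 < (c `^ s)^-1 by rewrite invr_gt0 powR_gt0.
  rewrite ler_pM2l ?expR_gt0// ler_pM2l// cB.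
  rewrite powRM ?invr_ge0 ?(ltW c0) ?(ltW m0)// cs.
  rewrite !(powRM s) ?powR_ge0 ?(ltW hC1)//.
  have := ler_wpM2l (mulr_ge0 (powR_ge0 C1 s) (ltW (mulr_gt0 c0 cs0))) kU.
  set z := (c `^ s)^-1; set z1 := C1 `^ s; set z2 := 2 `^ s; set z3 := (_ `^ p) `^ s.
  by move=> h; move: h; congr (_ <= _); ring.
have x0 : 0 < x by have := mulr_gt0 (expR_gt0 (1 : R)) B0; lra.
have mX t : measurable_fun setT (X t) by exact: measurable_funP.
have [mE PE] := level_excess_cvg_tail mX (fun N => level_excess_tail hC1 p0 p1 hq0
  (ltn0Sn _) mX XL b0 B0 (bK N.+1) wb).
apply: le_trans (le_trans PE _); last by rewrite lee_fin ler_expR lerN2 ltW.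
apply: le_measure; rewrite ?inE//.
  exact: (measurable_le_truncated_variation _ _ mX cX).
move=> z /= xz.
(* Since [x > 0], halving makes the inequality strict, as the reduction to dyadic subdivisions
   requires. *)
have : ((x / 2)%:E < truncated_variation c 0 1 (X ^~ z))%E.
  by apply: lt_le_trans xz; rewrite lte_fin; lra.
move=> /(lt_truncated_variation_dyadic c (x / 2) (cX z))[N [t [Nt xt]]].
exists N => //=; apply: (le_trans Bx); apply: ltW; apply: lt_le_trans xt _.
exact: tv_sum_le_level_excess.
Qed.
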